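(* Let $(F,\mathcal{N},\circ,\bullet)$ be a complete neutrosophic metric space and let $\{\gamma_n : n\in\mathbb{N}\}$ be a sequence of dense open subsets of $F$ (with respect to $\tau_{\mathcal{N}}$). Then $\bigcap_{n\in\mathbb{N}}\gamma_n$ is also dense in $F$.
   Context: A continuous t-norm is a continuous, commutative, associative operation $\circ:[0,1]\times[0,1]\to[0,1]$ with $s\circ 1=s$ for all $s$, and $s\circ t\le u\circ v$ whenever $s\le u$, $t\le v$. A continuous t-conorm is a continuous, commutative, associative operation $\bullet:[0,1]\times[0,1]\to[0,1]$ with $s\bullet 0=s$ for all $s$, and $s\bullet t\le u\bullet v$ whenever $s\le u$, $t\le v$. A neutrosophic metric space (NMS) is a four-tuple $(F,\mathcal{N},\circ,\bullet)$ where $F$ is a set, $\circ$ is a continuous t-norm, $\bullet$ is a continuous t-conorm, and $\mathcal{N}=(G,B,Y)$ consists of three functions $G,B,Y:F\times F\times(0,\infty)\to[0,1]$ such that for all $a,b,c\in F$ and all $\lambda,\mu>0$: (1) $G(a,b,\lambda)+B(a,b,\lambda)+Y(a,b,\lambda)\le 3$; (2) $G(a,b,\lambda)=1$ if and only if $a=b$; $B(a,b,\lambda)=0$ if and only if $a=b$; $Y(a,b,\lambda)=0$ if and only if $a=b$; (3) $G,B,Y$ are symmetric in their first two arguments; (4) $G(a,b,\lambda)\circ G(b,c,\mu)\le G(a,c,\lambda+\mu)$, $B(a,b,\lambda)\bullet B(b,c,\mu)\ge B(a,c,\lambda+\mu)$, $Y(a,b,\lambda)\bullet Y(b,c,\mu)\ge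 Y(a,c,\lambda+\mu)$; (5) $G(a,b,\cdot)$, $B(a,b,\cdot)$, $Y(a,b,\cdot)$ are continuous on $(0,\infty)$; (6) $\lim_{\lambda\to\infty}G(a,b,\lambda)=1$, $\lim_{\lambda\to\infty}B(a,b,\lambda)=0$, $\lim_{\lambda\to\infty}Y(a,b,\lambda)=0$. By convention, for $\lambda\le 0$ one sets $G(a,b,\lambda)=0$, $B(a,b,\lambda)=1$, $Y(a,b,\lambda)=1$. For $a\in F$, $0<\varepsilon<1$, $\lambda>0$, the open ball is $O(a,\varepsilon,\lambda)=\{b\in F: G(a,b,\lambda)>1-\varepsilon,\ B(a,b,\lambda)<\varepsilon,\ Y(a,b,\lambda)<\varepsilon\}$. The topology $\tau_{\mathcal{N}}$ on $F$ consists of all $A\subset F$ such that for each $a\in A$ there exist $\lambda>0$ and $\varepsilon\in(0,1)$ with $O(a,\varepsilon,\lambda)\subset A$; all topological notions in $F$ refer to $\tau_{\mathcal{N}}$. A sequence $(a_n)$ in $F$ is Cauchy if for each $\varepsilon>0$ and each $\lambda>0$ there exists $N\in\mathbb{N}$ such that $G(a_n,a_m,\lambda)>1-\varepsilon$, $B(a_n,a_m,\lambda)<\varepsilon$, $Y(a_n,a_m,\lambda)<\varepsilon$ for all $n,m\ge N$. The NMS is complete if every Cauchy sequence converges with respect to $\tau_{\mathcal{N}}$. *)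

(* Defs.v *)
From HB Require Import structures.
From mathcomp Require Import all_boot all_order all_algebra.
From mathcomp Require Import all_classical all_reals all_analysis.
Import Order.TTheory GRing.Theory Num.Theory.
Import numFieldNormedType.Exports.

Set Implicit Arguments.
Unset Strict Implicit.
Unset Printing Implicit Defensive.

Local Open Scope classical_set_scope.
Local Open Scope ring_scope.

(* Operations on [0,1] are total functions on R whose values outside the unit
   square are irrelevant: every axiom is restricted to [0,1], and continuity is
   joint continuity for the subspace topology of the square. *)
Section UnitIntervalOperations.
Context {R : realType}.

Record unit_operation (op : R -> R -> R) : Prop := UnitOperation {
  unit_op_closed : forall s t : R, s \in `[0, 1] -> t \in `[0, 1] ->
    op s t \in `[0, 1];
  unit_op_continuous :
    {within `[0, 1]%classic `*` `[0, 1]%classic,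
      continuous (fun p : R * R => op p.1 p.2)};
  unit_op_comm : forall s t : R, s \in `[0, 1] -> t \in `[0, 1] ->
    op s t = op t s;
  unit_op_assoc : forall s t u : R,
    s \in `[0, 1] -> t \in `[0, 1] -> u \in `[0, 1] ->
    op s (op t u) = op (op s t) u;
  unit_op_le : forall s t u v : R,
    s \in `[0, 1] -> t \in `[0, 1] -> u \in `[0, 1] -> v \in `[0, 1] ->
    s <= u -> t <= v -> op s t <= op u v
}.

Record continuous_tnorm (op : R -> R -> R) : Prop := ContinuousTNorm {
  tnorm_unit_operation : unit_operation op;
  tnorm1 : forall s : R, s \in `[0, 1] -> op s 1 = s
}.

Record continuous_tconorm (op : R -> R -> R) : Prop := ContinuousTConorm {
  tconorm_unit_operation : unit_operation op;
  tconorm0 : forall s : R, s \in `[0, 1] -> op s 0 = s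
}.

End UnitIntervalOperations.

(* G, B, Y take a real third argument; for nonpositive values of it they are
   the conventional constants 0, 1, 1, and all other axioms concern positive
   values only. *)
Record nms (R : realType) := NMS {
  nms_sort :> Type;
  nmsT : R -> R -> R;
  nmsS : R -> R -> R;
  nmsG : nms_sort -> nms_sort -> R -> R;
  nmsB : nms_sort -> nms_sort -> R -> R;
  nmsY : nms_sort -> nms_sort -> R -> R;
  nmsT_tnorm : continuous_tnorm nmsT;
  nmsS_tconorm : continuous_tconorm nmsS;
  nmsG_unit : forall a b (l : R), 0 < l -> nmsG a b l \in `[0, 1];
  nmsB_unit : forall a b (l : R), 0 < l -> nmsB a b l \in `[0, 1];
  nmsY_unit : forall a b (l : R), 0 < l -> nmsY a b l \in `[0, 1];
  nms_sum_le3 : forall a b (l : R), 0 < l ->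
    nmsG a b l + nmsB a b l + nmsY a b l <= 3;
  nmsG_eq1 : forall a b (l : R), 0 < l -> (nmsG a b l = 1 <-> a = b);
  nmsB_eq0 : forall a b (l : R), 0 < l -> (nmsB a b l = 0 <-> a = b);
  nmsY_eq0 : forall a b (l : R), 0 < l -> (nmsY a b l = 0 <-> a = b);
  nmsG_sym : forall a b (l : R), 0 < l -> nmsG a b l = nmsG b a l;
  nmsB_sym : forall a b (l : R), 0 < l -> nmsB a b l = nmsB b a l;
  nmsY_sym : forall a b (l : R), 0 < l -> nmsY a b l = nmsY b a l;
  nmsG_triangle : forall a b c (l m : R), 0 < l -> 0 < m ->
    nmsT (nmsG a b l) (nmsG b c m) <= nmsG a c (l + m);
  nmsB_triangle : forall a b c (l m : R), 0 < l -> 0 < m ->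
    nmsB a c (l + m) <= nmsS (nmsB a b l) (nmsB b c m);
  nmsY_triangle : forall a b c (l m : R), 0 < l -> 0 < m ->
    nmsY a c (l + m) <= nmsS (nmsY a b l) (nmsY b c m);
  nmsG_continuous : forall a b, {within `]0, +oo[, continuous (nmsG a b)};
  nmsB_continuous : forall a b, {within `]0, +oo[, continuous (nmsB a b)};
  nmsY_continuous : forall a b, {within `]0, +oo[, continuous (nmsY a b)};
  nmsG_lim : forall a b, nmsG a b l @[l --> +oo] --> (1 : R);
  nmsB_lim : forall a b, nmsB a b l @[l --> +oo] --> (0 : R);
  nmsY_lim : forall a b, nmsY a b l @[l --> +oo] --> (0 : R);
  nmsG_npos : forall a b (l : R), l <= 0 -> nmsG a b l = 0;
  nmsB_npos : forall a b (l : R), l <= 0 -> nmsB a b l = 1;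
  nmsY_npos : forall a b (l : R), l <= 0 -> nmsY a b l = 1
}.

Section NMSTopology.
Context {R : realType} (F : nms R).

Definition nms_ball (a : F) (e l : R) : set F :=
  [set b | [/\ 1 - e < nmsG a b l, nmsB a b l < e & nmsY a b l < e]].

Definition nms_open (A : set F) : Prop :=
  forall a, A a -> exists l e : R,
    [/\ 0 < l, 0 < e, e < 1 & nms_ball a e l `<=` A].

Lemma nmsG_le (a b : F) (l m : R) : 0 < l -> l <= m ->
  nmsG a b l <= nmsG a b m.
Proof.
move=> l0; rewrite le_eqVlt => /predU1P[->//|lm].
have ml0 : 0 < m - l by rewrite subr_gt0.
have := nmsG_triangle a b b l0 ml0.
rewrite (proj2 (nmsG_eq1 b b ml0) erefl) (tnorm1 (nmsT_tnorm F)).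
  by rewrite addrC subrK.
exact: nmsG_unit.
Qed.

Lemma nmsB_ge (a b : F) (l m : R) : 0 < l -> l <= m ->
  nmsB a b m <= nmsB a b l.
Proof.
move=> l0; rewrite le_eqVlt => /predU1P[->//|lm].
have ml0 : 0 < m - l by rewrite subr_gt0.
have := nmsB_triangle a b b l0 ml0.
rewrite (proj2 (nmsB_eq0 b b ml0) erefl) (tconorm0 (nmsS_tconorm F)).
  by rewrite [l + _]addrC subrK.
exact: nmsB_unit.
Qed.

Lemma nmsY_ge (a b : F) (l m : R) : 0 < l -> l <= m ->
  nmsY a b m <= nmsY a b l.
Proof.
move=> l0; rewrite le_eqVlt => /predU1P[->//|lm].
have ml0 : 0 < m - l by rewrite subr_gt0.
have := nmsY_triangle a b b l0 ml0.
rewrite (proj2 (nmsY_eq0 b b ml0) erefl) (tconorm0 (nmsS_tconorm F)).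
  by rewrite [l + _]addrC subrK.
exact: nmsY_unit.
Qed.

Lemma nms_ball_le (a : F) (e1 e2 l1 l2 : R) : 0 < l1 -> l1 <= l2 -> e1 <= e2 ->
  nms_ball a e1 l1 `<=` nms_ball a e2 l2.
Proof.
move=> l0 l12 e12 b [G1 B1 Y1]; split.
- apply: le_lt_trans (lt_le_trans G1 (nmsG_le a b l0 l12)).
  by rewrite lerD2l lerN2.
- exact: le_lt_trans (nmsB_ge a b l0 l12) (lt_le_trans B1 e12).
- exact: le_lt_trans (nmsY_ge a b l0 l12) (lt_le_trans Y1 e12).
Qed.

Lemma nms_openT : nms_open setT.
Proof.
move=> a _; exists 1, 2^-1.
by split; rewrite ?ltr01 ?invr_gt0 ?ltr0n ?invf_lt1 ?ltr1n ?ltr0n.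
Qed.

Lemma nms_openI : setI_closed nms_open.
Proof.
move=> A B oA oB a [/oA[l1 [e1 [l10 e10 e11 sA]]] /oB[l2 [e2 [l20 e20 _ sB]]]].
have l0 : 0 < Num.min l1 l2 by rewrite lt_min l10.
exists (Num.min l1 l2), (Num.min e1 e2); split => //.
- by rewrite lt_min e10.
- by rewrite gt_min e11.
- move=> b ab; split; [apply: sA|apply: sB];
  by apply: (nms_ball_le _ _ _ ab) => //; rewrite ge_min lexx ?orbT.
Qed.

Lemma nms_open_bigU (I : Type) (f : I -> set F) :
  (forall i, nms_open (f i)) -> nms_open (\bigcup_i f i).
Proof.
move=> of_ a [i _ /of_[l [e [l0 e0 e1 sf]]]]; exists l, e; split => //.
by move=> b /sf fb; exists i.
Qed.

End NMSTopology.

HB.instance Definition _ (R : realType) (F : nms R) := gen_eqMixin (nms_sort F).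
HB.instance Definition _ (R : realType) (F : nms R) :=
  gen_choiceMixin (nms_sort F).
HB.instance Definition _ (R : realType) (F : nms R) :=
  isOpenTopological.Build (nms_sort F) (@nms_openT R F) (@nms_openI R F)
    (@nms_open_bigU R F).

Lemma nms_openE (R : realType) (F : nms R) (A : set F) :
  open A <-> nms_open A.
Proof. by []. Qed.

Section Completeness.
Context {R : realType} (F : nms R).

Definition nms_cauchy (u : nat -> F) : Prop :=
  forall e l : R, 0 < e -> 0 < l -> exists N : nat,
    forall n m : nat, (N <= n)%N -> (N <= m)%N ->
      [/\ 1 - e < nmsG (u n) (u m) l,
          nmsB (u n) (u m) l < e & nmsY (u n) (u m) l < e].

Definition nms_complete : Prop :=
  forall u : nat -> F, nms_cauchy u -> exists a : F, u @ \oo --> a.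

End Completeness.

(* Main.v *)
(* The sets [nms_ball a e e] are the sections of the members of a uniformity
   with a countable base: continuity of the t-norm at (1,1) and of the t-conorm
   at (0,0) yields, for each [e], some [d] for which the [d]-relation composed
   with itself lies in the [e]-relation.  One chooses balls of radii [r n -> 0]
   such that the ball number [n.+1] lies in [gamma n] and in the ball of radius
   [d (r n)] inside the ball number [n].  The centers form a Cauchy sequence,
   and because of the halved radii its limit stays in every ball without any
   recourse to closed balls. *)
Require Import Defs.
From mathcomp Require Import all_boot all_order all_algebra.
From mathcomp Require Import all_classical all_reals all_analysis.
From mathcomp Require Import lra.
Import Order.TTheory GRing.Theory Num.Theory.
Import numFieldNormedType.Exports.

Set Implicit Arguments.
Unset Strict Implicit.
Unset Printing Implicit Defensive.

Local Open Scope classical_set_scope.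

Section NMSUniformity.
Local Open Scope ring_scope.
Context {R : realType}.

Lemma unit_operation_near (op : R -> R -> R) (p q e : R) :
  unit_operation op -> p \in `[0, 1] -> q \in `[0, 1] -> 0 < e ->
  exists2 d : R, 0 < d & forall x y : R, x \in `[0, 1] -> y \in `[0, 1] ->
    `|p - x| < d -> `|q - y| < d -> `|op p q - op x y| < e.
Proof.
move=> [_ cop _ _ _] p01 q01 e0.
have {}cop := proj1 (subspace_continuousP _ _) cop (p, q) (conj p01 q01).
move/cvgrPdist_lt: cop => /(_ e e0)/=.
rewrite near_withinE => /nbhs_ballP[d/= d0 dop].
by exists d => // x y x01 y01 px qy; apply: (dop (x, y)).
Qed.

Context (F : nms R).

Definition nms_near (e : R) (a : F) : set F := nms_ball a e e.

Lemma nms_near_refl (e : R) (a : F) : 0 < e -> nms_near e a a.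
Proof.
move=> e0; rewrite /nms_near /nms_ball/= (proj2 (nmsG_eq1 a a e0) erefl).
rewrite (proj2 (nmsB_eq0 a a e0) erefl) (proj2 (nmsY_eq0 a a e0) erefl).
by split => //; rewrite ltrBlDr ltrDl.
Qed.

Lemma nms_near_sym (e : R) (a b : F) : 0 < e -> nms_near e a b -> nms_near e b a.
Proof.
move=> e0 [Ge Be Ye]; split.
- by rewrite nmsG_sym.
- by rewrite nmsB_sym.
- by rewrite nmsY_sym.
Qed.

Lemma nms_near_le (d e : R) (a : F) : 0 < d -> d <= e ->
  nms_near d a `<=` nms_near e a.
Proof. by move=> d0 de; exact: nms_ball_le. Qed.

Lemma nms_near_split (e : R) : 0 < e -> exists d : R,
  [/\ 0 < d, d <= e & forall a b c : F,
    nms_near d a b -> nms_near d b c -> nms_near e a c].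
Proof.
move=> e0.
have i0 : (0 : R) \in `[0, 1] by rewrite in_itv/= lexx ler01.
have i1 : (1 : R) \in `[0, 1] by rewrite in_itv/= lexx ler01.
have [d1 d10 T1] := unit_operation_near
  (tnorm_unit_operation (nmsT_tnorm F)) i1 i1 e0.
have [d2 d20 S0] := unit_operation_near
  (tconorm_unit_operation (nmsS_tconorm F)) i0 i0 e0.
rewrite (tnorm1 (nmsT_tnorm F) i1) in T1.
rewrite (tconorm0 (nmsS_tconorm F) i0) in S0.
(* The triangle inequalities at [d] and [d] bound the values at [d + d]; monotonicity carries these
   bounds to [e] once [d + d <= e]. *)
have [d [d0 dd1 dd2 de]] :
    exists d : R, [/\ 0 < d, d <= d1, d <= d2 & d + d <= e].
  exists (Num.min (Num.min d1 d2) (e / 2)); split.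
  - by rewrite !lt_min d10 d20 divr_gt0.
  - by rewrite !ge_min lexx.
  - by rewrite !ge_min lexx orbT.
  - by rewrite [leRHS](splitr e) lerD// ge_min lexx orbT.
exists d; split => //; first by lra.
have dist0 (x : R) : x \in `[0, 1] -> x < d -> `|0 - x| < d2.
  rewrite in_itv/= => /andP[x0 _] xd.
  by rewrite sub0r normrN ger0_norm//; lra.
have dist1 (x : R) : x \in `[0, 1] -> 1 - d < x -> `|1 - x| < d1.
  rewrite in_itv/= => /andP[_ x1] xd.
  by rewrite ger0_norm ?subr_ge0//; lra.
have dd0 : 0 < d + d by lra.
have S_lt (x y : R) : x \in `[0, 1] -> y \in `[0, 1] -> x < d -> y < d ->
    nmsS F x y < e.
  move=> x01 y01 xd yd.
  have := S0 x y x01 y01 (dist0 _ x01 xd) (dist0 _ y01 yd).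
  by rewrite sub0r normrN; apply: le_lt_trans; exact: ler_norm.
move=> a b c [Gab Bab Yab] [Gbc Bbc Ybc].
apply: (nms_ball_le dd0 de (lexx e)); split.
- have := T1 _ _ (nmsG_unit a b d0) (nmsG_unit b c d0)
    (dist1 _ (nmsG_unit a b d0) Gab) (dist1 _ (nmsG_unit b c d0) Gbc).
  move=> /(le_lt_trans (ler_norm _)) Te.
  by have := nmsG_triangle a b c d0 d0; lra.
- exact: le_lt_trans (nmsB_triangle a b c d0 d0)
    (S_lt _ _ (nmsB_unit a b d0) (nmsB_unit b c d0) Bab Bbc).
- exact: le_lt_trans (nmsY_triangle a b c d0 d0)
    (S_lt _ _ (nmsY_unit a b d0) (nmsY_unit b c d0) Yab Ybc).
Qed.

(** Balls grow with both parameters, so the smaller of the two can serve as both. *)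
Lemma open_nms_near (A : set F) (a : F) : open A -> A a ->
  exists2 r : R, 0 < r & nms_near r a `<=` A.
Proof.
move=> /nms_openE oA /oA[l [e [l0 e0 _ sA]]].
have m0 : 0 < Num.min e l by rewrite lt_min e0.
exists (Num.min e l) => //; apply: subset_trans sA.
by apply: nms_ball_le; rewrite ?ge_min ?lexx ?orbT.
Qed.

(** Openness of the ball itself is not established: the set [W] of points around which a whole ball
    fits inside is open by [nms_near_split], and it contains [a]. *)
Lemma nms_near_nbhs (e : R) (a : F) : 0 < e -> nbhs a (nms_near e a).
Proof.
move=> e0; pose W := [set b : F | exists2 s : R, 0 < s &
  nms_near s b `<=` nms_near e a].
rewrite nbhsE; exists W => /=.
- split; last by exists e.
  apply/nms_openE => b [s s0 sW].
  have [d [d0 ds dd]] := nms_near_split s0.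
  (* The cap at one half meets the demand of [nms_open] for a threshold below 1. *)
  have m0 : 0 < Num.min d 2^-1 by rewrite lt_min d0 invr_gt0 ltr0n.
  exists (Num.min d 2^-1), (Num.min d 2^-1); split => //.
    by rewrite gt_min invf_lt1 ?ltr1n ?ltr0n ?orbT.
  move=> c bc; exists d => // x cx; apply: sW; apply: dd cx.
  by apply: nms_near_le bc; rewrite ?ge_min ?lexx.
- by move=> b [s s0]; apply; exact: nms_near_refl.
Qed.

End NMSUniformity.

Theorem theorem3p17 (R : realType) (F : nms R) (gamma : nat -> set F) :
  nms_complete F ->
  (forall n : nat, open (gamma n)) ->
  (forall n : nat, dense (gamma n)) ->
  dense (\bigcap_n gamma n).
Proof.
Local Open Scope ring_scope.
move=> cF og dg O [a0 Oa0] oO.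
have [r0 r00 r0O] := open_nms_near oO Oa0.
have /choice[d dP] (e : R) : exists d : R, 0 < e ->
    [/\ 0 < d, d <= e & forall a b c : F,
      nms_near d a b -> nms_near d b c -> nms_near e a c].
  have [e0|] := boolP (0 < e); last by exists 0.
  by have [d] := nms_near_split F e0; exists d.
(* One step of the construction: from an index, a center and a radius, [f] yields the next center
   and radius. Inputs with nonpositive radius get a dummy value. *)
have /choice[f fP] (k : nat * (F * R)) : exists q : F * R, 0 < k.2.2 ->
    [/\ 0 < q.2, q.2 <= k.1.+1%:R^-1,
      nms_near q.2 q.1 `<=` nms_near (d k.2.2) k.2.1 &
      nms_near q.2 q.1 `<=` gamma k.1].
  case: k => n [x r] /=.
  have [r_gt0|] := boolP (0 < r); last by exists (x, r).
  have [dr0 _ _] := dP r r_gt0.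
  have := nms_near_nbhs x dr0; rewrite nbhsE => -[W [oW Wx] sW].
  have [y [Wy gy]] := dg n W (ex_intro _ x Wx) oW.
  have [s s0 sWg] := open_nms_near (openI oW (og n)) (conj Wy gy).
  have m0 : 0 < Num.min s n.+1%:R^-1 by rewrite lt_min s0 invr_gt0 ltr0n.
  exists (y, Num.min s n.+1%:R^-1) => _ /=; split => //.
  - by rewrite ge_min lexx orbT.
  - move=> z yz; apply: sW; apply: (proj1 (sWg z _)).
    by apply: nms_near_le yz; rewrite // ge_min lexx.
  - move=> z yz; apply: (proj2 (sWg z _)).
    by apply: nms_near_le yz; rewrite // ge_min lexx.
pose z := fix z n := if n is m.+1 then f (m, z m) else (a0, r0).
pose x n := (z n).1; pose r n := (z n).2.
have r_gt0 n : 0 < r n.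
  by elim: n => [//|n IH]; have [] := fP (n, z n) IH.
have step n : [/\ r n.+1 <= n.+1%:R^-1,
    nms_near (r n.+1) (x n.+1) `<=` nms_near (d (r n)) (x n) &
    nms_near (r n.+1) (x n.+1) `<=` gamma n].
  by have [] := fP (n, z n) (r_gt0 n).
have nested n k :
    nms_near (r (n + k)%N) (x (n + k)%N) `<=` nms_near (r n) (x n).
  elim: k => [|k IH]; first by rewrite addn0.
  rewrite addnS; apply: subset_trans IH.
  have [_ s _] := step (n + k)%N; apply: (subset_trans s).
  by have [d0 dr _] := dP _ (r_gt0 (n + k)%N); exact: nms_near_le.
(* The inequality is strict because only the balls after number [n] lie in the shrunken ball of
   radius [d (r n)]. *)
have x_near n m : (n < m)%N -> nms_near (d (r n)) (x n) (x m).
  move=> /subnKC <-; have [_ s _] := step n; apply/s/nested.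
  exact: nms_near_refl.
have [y xy] : exists y : F, x @ \oo --> y.
  apply: cF => e l e0 l0.
  have m0 : 0 < Num.min e l by rewrite lt_min e0.
  have [N Nm] : exists N : nat, N.+1%:R^-1 < Num.min e l.
    by exists (Num.bound (Num.min e l)^-1);
      rewrite invf_plt ?posrE ?ltr0n//; apply: lt_trans (archi_boundP _) _;
      rewrite ?invr_ge0 ?ltW// ltr_nat.
  (* Both terms are compared with [x N.+1], whose radius is at most [N.+1%:R^-1]; [x_near] then
     requires indices from [N.+2] on. *)
  exists N.+2 => n m Nn Nm'.
  have [d0 _ dd] := dP _ (r_gt0 N.+1).
  have [rN _ _] := step N.
  have := dd _ _ _ (nms_near_sym d0 (x_near _ _ Nn)) (x_near _ _ Nm').
  by apply: nms_ball_le => //; apply: (le_trans rN);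
    apply: le_trans (ltW Nm) _; rewrite ge_min lexx ?orbT.
(* A late term [x m] is [d (r n)]-near both to [x n] and to the limit, so composing the two gives
   [r n]-nearness. The index [maxn M n.+1] is late enough for both. *)
have y_near n : nms_near (r n) (x n) y.
  have [d0 _ dd] := dP _ (r_gt0 n).
  have [M _ xM] := xy _ (nms_near_nbhs y d0).
  apply: dd (x_near n (maxn M n.+1) _) _; first by rewrite leq_max leqnn orbT.
  apply: nms_near_sym => //; apply: xM => /=; exact: leq_maxl.
exists y; split; first exact/r0O/(y_near 0%N).
by move=> n _; have [_ _] := step n; apply; exact: y_near.
Qed.
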